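(* Fix $L>0$. There exist a dimension $d\ge1$, a convex $L$-smooth function $f:\mathbb{R}^d\to\mathbb{R}$, a stepsize $\eta$ with $1.75/L<\eta<2/L$, an initialization $x_0\in\mathbb{R}^d$, and an index $n\ge0$ such that, for the gradient descent iterates $x_{k+1}=x_k-\eta\nabla f(x_k)$, $k\ge0$, and with $\Delta_k:=f(x_k)-f(x_{k+1})$, $$\Delta_n-\Delta_{n+1}<\eta\Bigl(1-\tfrac{\eta L}{2}\Bigr)\bigl(\|\nabla f(x_{n+1})\|^2-\|\nabla f(x_{n+2})\|^2\bigr).$$
   Context: A differentiable function $f:\mathbb{R}^d\to\mathbb{R}$ is $L$-smooth if its gradient is Lipschitz continuous with constant $L$ with respect to the Euclidean norm $\|\cdot\|$. *)

(* Defs.v *)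
From mathcomp Require Import all_boot all_order all_algebra.
From mathcomp Require Import all_classical all_reals all_analysis.

Set Implicit Arguments.
Unset Strict Implicit.
Unset Printing Implicit Defensive.

Import Order.TTheory GRing.Theory Num.Theory.
Import numFieldNormedType.Exports.

Local Open Scope ring_scope.

Section GradientDescent.
Context {R : realType} {d : nat}.
Implicit Types (f : 'rV[R]_d -> R) (x y : 'rV[R]_d).

(* The library norm `|x| on 'rV[R]_d is the sup norm; it induces the same
   topology, hence the same notion of differentiability. *)
Definition enorm x : R := Num.sqrt (\sum_(i < d) x ord0 i ^+ 2).

(* The limit defining 'D_v f x has a junk value when it does not exist, so
   this is the gradient only where f is differentiable. *)
Definition gradient f x : 'rV[R]_d := \row_(i < d) 'D_(delta_mx ord0 i) f x.

Definition smooth (L : R) f : Prop :=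
  (forall x, differentiable f x) /\
  (forall x y, enorm (gradient f x - gradient f y) <= L * enorm (x - y)).

Definition gd (eta : R) f (x0 : 'rV[R]_d) (k : nat) : 'rV[R]_d :=
  iter k (fun x => x - eta *: gradient f x) x0.

End GradientDescent.

(* Main.v *)
Require Import Defs.
From mathcomp Require Import all_boot all_order all_algebra.
From mathcomp Require Import all_classical all_reals all_analysis.
From mathcomp Require Import ring lra.

Import Order.TTheory GRing.Theory Num.Theory.
Import numFieldNormedType.Exports.

Local Open Scope ring_scope.

(** The one-dimensional one-sided Huber function [h], equal to [t^2/2] for
    [t <= 1] and affine beyond, already gives a counterexample.  With [f = L h]
    and [eta = 9/(5L)], starting at [-9/5] on the parabola, the first step
    overshoots to [36/25] on the affine part, and the second step lands at
    [-9/25], near the minimum.  The second decrease of [f] exceeds the first, so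
    the left-hand side is negative, while the gradient norm drops from [L] to
    [9L/25] and the right-hand side is positive. *)

Section Huber.
Context {R : realType}.
Implicit Types (L s t : R).
Local Open Scope classical_set_scope.
Local Open Scope ring_scope.

Definition huber t : R := if t <= 1 then t ^+ 2 / 2 else t - 1 / 2.

Definition huber_slope t : R := if t <= 1 then t else 1.

(** This is convexity in first-order form; when [s] and [t] lie on the same piece, the gap is
    [(t - s) ^+ 2 / 2] or zero. *)
Lemma huber_ge_tangent s t : huber s + huber_slope s * (t - s) <= huber t.
Proof.
have := sqr_ge0 (s - 1); have := sqr_ge0 (t - 1); have := sqr_ge0 (t - s).
by rewrite /huber /huber_slope; case: (leP s 1) => ?; case: (leP t 1) => ?; nra.
Qed.

Lemma huber_le_quadratic s t :
  huber t <= huber s + huber_slope s * (t - s) + (t - s) ^+ 2 / 2.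
Proof.
have := sqr_ge0 (s - 1); have := sqr_ge0 (t - 1); have := sqr_ge0 (t - s).
by rewrite /huber /huber_slope; case: (leP s 1) => ?; case: (leP t 1) => ?; nra.
Qed.

(** The slope is the truncation [min(t, 1)], which is nonexpansive. *)
Lemma huber_slope_lipschitz s t : `|huber_slope s - huber_slope t| <= `|s - t|.
Proof.
have := ler_norm (s - t); have := ler_norm (t - s); rewrite distrC ler_norml.
move=> ? ?; apply/andP; rewrite /huber_slope.
by split; case: (leP s 1) => ?; case: (leP t 1) => ?; lra.
Qed.

(** The tangent and quadratic bounds squeeze the difference quotient to within [|k|] of the slope,
    so the kink at [1] needs no separate case. *)
Lemma is_derive_huber t : is_derive t 1 huber (huber_slope t).
Proof.
suff cv : (k^-1 *: ((huber \o shift t) (k *: 1) - huber t) : R)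
    @[k --> 0^'] --> huber_slope t.
  by split; [apply/cvg_ex; exists (huber_slope t)|exact: cvg_lim].
apply/cvgrPdist_le => e e0; near=> k.
have k0 : k != 0 by near: k; exact: nbhs_dnbhs_neq.
have ke : `|k| <= e by near: k; exact: dnbhs0_le.
rewrite /= -[k *: 1]/(k * 1) mulr1 -[_ *: _]/(k^-1 * _).
have lo := huber_ge_tangent t (k + t).
have up := huber_le_quadratic t (k + t).
rewrite addrK in lo up.
(* Multiplying by [|k|] clears the inverse, whatever the sign of [k], and leaves an error bound
   [k ^+ 2]. *)
apply: le_trans ke; rewrite -(ler_pM2l (x := `|k|)) ?normr_gt0// -normrM.
rewrite mulrBr mulrA mulfV// mul1r -normrM -expr2 (ger0_norm (sqr_ge0 k)).
have := sqr_ge0 k; rewrite ler_norml => ?.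
by apply/andP; split; lra.
Unshelve. all: by end_near. Qed.

Definition huber_rV L (x : 'rV[R]_1) : R := L * huber (x ord0 ord0).

Lemma differentiable_huber_rV L x : differentiable (huber_rV L) x.
Proof.
apply: (@differentiable_comp _ _ _ _ (fun y : 'rV[R]_1 => y ord0 ord0 : R)
  (fun t => L * huber t)).
  exact: differentiable_coord.
apply/derivable1_diffP.
by have [] := is_deriveZ L (is_derive_huber (x ord0 ord0)).
Qed.

Lemma gradient_huber_rV L x :
  gradient (huber_rV L) x = const_mx (L * huber_slope (x ord0 ord0)).
Proof.
apply/rowP => i; rewrite (ord1 i) !mxE.
have [_] := is_deriveZ L (is_derive_huber (x ord0 ord0)).
rewrite -[_ *: huber_slope _]/(L * huber_slope (x ord0 ord0)) => <-.
(* Both derivatives are limits of difference quotients, which agree pointwise along the only basis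
   vector. *)
rewrite /derive; apply: (congr1 (fun g : R -> R => lim (g @ 0^'))).
by apply/funext => k; rewrite /= /huber_rV !mxE eqxx.
Qed.

Lemma enorm_rV1 (x : 'rV[R]_1) : enorm x = `|x ord0 ord0|.
Proof. by rewrite /enorm big_ord1 sqrtr_sqr. Qed.

Lemma smooth_huber_rV L : 0 <= L -> smooth L (huber_rV L).
Proof.
move=> L0; split=> [x|x y]; first exact: differentiable_huber_rV.
rewrite !gradient_huber_rV !enorm_rV1 !mxE -mulrBr normrM ger0_norm//.
exact: ler_wpM2l (huber_slope_lipschitz _ _).
Qed.

(** Average the tangent inequalities at [z] towards [x] and [y]: the slope terms cancel because [z]
    is the weighted mean. *)
Lemma convex_huber_rV L :
  0 <= L -> convex_function [set: 'rV[R]_1]%classic (huber_rV L).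
Proof.
move=> L0 p x y _ _.
have p0 : 0 <= p%:num by [].
have p1 : p%:num <= 1 by [].
rewrite convRE /huber_rV; set z := conv p x y.
have zE : z ord0 ord0 = p%:num * x ord0 ord0 + (1 - p%:num) * y ord0 ord0.
  by rewrite !mxE.
have hx := huber_ge_tangent (z ord0 ord0) (x ord0 ord0).
have hy := huber_ge_tangent (z ord0 ord0) (y ord0 ord0).
rewrite mulrCA [X in _ + X]mulrCA -mulrDr; apply: ler_wpM2l => //.
have q0 : 0 <= 1 - p%:num by rewrite subr_ge0.
have := lerD (ler_wpM2l p0 hx) (ler_wpM2l q0 hy).
apply: le_trans; move: zE {hx hy}.
move: (z ord0 ord0) (x ord0 ord0) (y ord0 ord0) (p%:num) => w a b q wE.
have -> : q * (huber w + huber_slope w * (a - w)) +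
    (1 - q) * (huber w + huber_slope w * (b - w)) =
    huber w + huber_slope w * (q * a + (1 - q) * b - w) by ring.
by rewrite -wE subrr mulr0 addr0.
Qed.

End Huber.

Theorem proposition5p2 (R : realType) (L : R) (hL : 0 < L) :
  exists (d : nat) (f : 'rV[R]_d -> R) (eta : R) (x0 : 'rV[R]_d) (n : nat),
    let x := gd eta f x0 in
    let Delta := fun k : nat => f (x k) - f (x k.+1) in
    [/\ (1 <= d)%N,
        convex_function [set: 'rV[R]_d]%classic f,
        smooth L f,
        (7%:R / 4%:R) / L < eta < 2%:R / L &
        Delta n - Delta n.+1 <
          eta * (1 - eta * L / 2%:R) *
            (enorm (gradient f (x n.+1)) ^+ 2 - enorm (gradient f (x n.+2)) ^+ 2)].
Proof.
exists 1, (huber_rV L), (9 / 5 / L), (const_mx (- (9 / 5))), 0 => x Delta.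
have Lneq0 : L != 0 by rewrite gt_eqF.
(* The [L] in the gradient cancels the [1 / L] in the stepsize, so the iterates do not depend on
   [L]. *)
have step k : x k.+1 ord0 ord0 =
    x k ord0 ord0 - 9 / 5 * huber_slope (x k ord0 ord0).
  rewrite /x /gd iterS gradient_huber_rV !mxE.
  by congr (_ - _); field.
have x0E : x 0 ord0 ord0 = - (9 / 5) by rewrite mxE.
clearbody x.
have gt1 : (36 / 25 <= 1 :> R) = false by apply/negbTE; rewrite -ltNge; lra.
have x1E : x 1 ord0 ord0 = 36 / 25.
  by rewrite step x0E /huber_slope ifT; lra.
have x2E : x 2 ord0 ord0 = - (9 / 25).
  by rewrite step x1E /huber_slope gt1; lra.
have h0 : huber (x 0 ord0 ord0) = 81 / 50.
  by rewrite x0E /huber ifT; lra.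
have [h1 s1] : huber (x 1 ord0 ord0) = 47 / 50 /\ huber_slope (x 1 ord0 ord0) = 1.
  by rewrite x1E /huber /huber_slope gt1; split; lra.
have [h2 s2] : huber (x 2 ord0 ord0) = 81 / 1250 /\
    huber_slope (x 2 ord0 ord0) = - (9 / 25).
  by rewrite x2E /huber /huber_slope !ifT; lra.
split=> //.
- exact/convex_huber_rV/ltW.
- exact/smooth_huber_rV/ltW.
- by rewrite !ltr_pM2r ?invr_gt0//; apply/andP; split; lra.
have gE k : enorm (gradient (huber_rV L) (x k)) ^+ 2 =
    (L * huber_slope (x k ord0 ord0)) ^+ 2.
  by rewrite gradient_huber_rV enorm_rV1 mxE real_normK ?num_real.
rewrite !gE /Delta /huber_rV h0 h1 h2 s1 s2.
(* Both sides are multiples of [L]; dividing it out leaves [- (122 / 625)] on the left against a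
   positive number. *)
have -> : 9 / 5 / L * (1 - 9 / 5 / L * L / 2) *
    ((L * 1) ^+ 2 - (L * - (9 / 25)) ^+ 2) = L * (9 / 50 * (1 - 81 / 625)).
  by field.
by rewrite -!mulrBr ltr_pM2l//; lra.
Qed.
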